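(* In the antithesis translation, an $\mathfrak L$-subgroup $H$ of an $\mathfrak L$-group $G$ is: \begin{enumerate} \item an $\mathfrak I$-subgroup $H$ of the $\mathfrak I$-group $G$; together with \item an $\mathfrak I$-subset $\bar H$ of $G$ satisfying the following axioms: \begin{align*} (x\in H)\wedge(y\in\bar H)&\vdash_{x,y:G}(x\neq y)\\ (x^{-1}\in\bar H)&\vdash_{x:G}(x\in\bar H)\\ (xy\in\bar H)\wedge(x\in H)&\vdash_{x,y:G}(y\in\bar H)\\ (xy\in\bar H)\wedge(y\in H)&\vdash_{x,y:G}(x\in\bar H). \end{align*} \end{enumerate} Moreover: \begin{itemize} \item $H$ is strong if and only if the last two axioms are replaced by the stronger one $(xy\in\bar H)\vdash_{x,y:G}(x\in\bar H)\vee(y\in\bar H)$. \item An affirmative $\mathfrak L$-subgroup of an affirmative $\mathfrak L$-group is precisely an $\mathfrak I$-subgroup of an $\mathfrak I$-group, together with its logical complement $\bar H=\{x\in G\mid\neg(x\in H)\}$. \item If $G$ is refutative and strong, then $H$ is refutative and strong if and only if $\bar H$ is an antisubgroup compatible with the apartness and $H$ is its logical complement $\{x\in G\mid\neg(x\in\bar H)\}$. \end{itemize}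
   Context: Intuitionistic ($\mathfrak I$-) side. We work in intuitionistic predicate logic over types. An $\mathfrak I$-set is a type with an equivalence relation $=$; functions, relations and subsets respect $=$; $\mathfrak I$-groups and $\mathfrak I$-subgroups are as usual. An inequality relation is an irreflexive symmetric relation $\neq$ respecting $=$; it is an apartness if $(x\neq z)\to(x\neq y)\vee(y\neq z)$, and tight if $\neg(x\neq y)$ implies $x=y$. For a group with a tight apartness for which the operations are strongly extensional, an antisubgroup compatible with the apartness is an $\mathfrak I$-subset $K$ such that $x\in K\Rightarrow x\neq e$; $\ x^{-1}\in K\Rightarrow x\in K$; and $xy\in K\Rightarrow(x\in K)\vee(y\in K)$. Antithesis translation. An affine ($\mathfrak L$-) predicate on a type is interpreted as a pair $P=(P^+,P^-)$ of intuitionistic predicates with $\neg(P^+\wedge P^-)$ (pointwise). Types and terms are unchanged. $P\vdash Q$ means both $P^+\vdash Q^+$ and $Q^-\vdash P^-$; $\vdash Q$ means $\top\vdash Q$, $\top=(\mathbf 1,\mathbf 0)$ (true, false). Connectives: $$P\boxtimes Q=(P^+\wedge Q^+,(P^+\to Q^-)\wedge(Q^+\to P^-)),\quad P\sqcap Q=(P^+\wedge Q^+,P^-\vee Q^-),\quad !P=(P^+,\neg P^+),\quad ?P=(\neg P^-,P^-).$$ $P$ is affirmative if $P\equiv\,!P$, refutative if $P\equiv\,?P$. An $\mathfrak L$-set is a type with an $\mathfrak L$-predicate $\circeq$ with $\vdash x\circeq x$, $x\circeq y\vdash y\circeq x$, $(x\circeq y)\boxtimes(y\circeq z)\vdash x\circeq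 z$; write $(x\circeq y)=((x=y),(x\neq y))$. An $\mathfrak L$-function is an operation with $x_1\circeq x_2\vdash f(x_1)\circeq f(x_2)$. $A\times B$ has equality $(x_1\circeq x_2)\sqcap(y_1\circeq y_2)$; $A\boxtimes B$ has the same underlying type with equality $(x_1\circeq x_2)\boxtimes(y_1\circeq y_2)$. An $\mathfrak L$-subset of $A$ is an $\mathfrak L$-predicate $U$ with $(x\circeq y)\boxtimes U(x)\vdash U(y)$; its positive part is written $x\in U$ and its negative part $x\in\bar U$ on the intuitionistic side. An $\mathfrak L$-group is an $\mathfrak L$-set $G$ with an element $e$ and $\mathfrak L$-functions $m:G\boxtimes G\to G$ and $i:G\to G$ satisfying the usual unit, inverse and associativity laws up to $\circeq$; write $xy=m(x,y)$, $x^{-1}=i(x)$. It is strong if $m$ is an $\mathfrak L$-function on $G\times G$. It is affirmative (refutative) if its equality predicate is. An $\mathfrak L$-subgroup of $G$ is an $\mathfrak L$-subset $H$ with $\vdash H(e)$; $\ H(x)\vdash H(x^{-1})$; $\ H(x)\boxtimes H(y)\vdash H(xy)$. It is strong if moreover $H(x)\sqcap H(y)\vdash H(xy)$, and affirmative (refutative) if the predicate $H$ is. *)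

(* Defs.v *)
From Stdlib Require Import RelationClasses Morphisms.

Set Implicit Arguments.
Unset Strict Implicit.

(** Affine propositions are disjoint pairs of intuitionistic ones. Intuitionistic logic is Rocq's [Prop], and intuitionistic entailment between
    predicates is pointwise implication. *)

Record Lprop : Type := mkLprop {
  pos : Prop;
  neg : Prop;
  pos_neg : ~ (pos /\ neg) }.
Arguments pos_neg : clear implicits.

Declare Scope L_scope.
Delimit Scope L_scope with L.
Bind Scope L_scope with Lprop.

Definition Lentails (P Q : Lprop) : Prop :=
  (pos P -> pos Q) /\ (neg Q -> neg P).
Notation "P ⊢ Q" := (Lentails P%L Q%L) (at level 70, no associativity).

Definition Lequiv (P Q : Lprop) : Prop := P ⊢ Q /\ Q ⊢ P.
Notation "P ≡ Q" := (Lequiv P%L Q%L) (at level 70, no associativity).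

Definition Ltop : Lprop.
Proof. refine (@mkLprop True False _); abstract tauto. Defined.

Notation "⊢ P" := (Lentails Ltop P%L) (at level 70).

Definition Ltensor (P Q : Lprop) : Lprop.
Proof.
refine (@mkLprop (pos P /\ pos Q)
                 ((pos P -> neg Q) /\ (pos Q -> neg P)) _).
abstract (generalize (pos_neg P); tauto).
Defined.
Notation "P ⊠ Q" := (Ltensor P Q) (at level 40, left associativity) : L_scope.

Definition Lmeet (P Q : Lprop) : Lprop.
Proof.
refine (@mkLprop (pos P /\ pos Q) (neg P \/ neg Q) _).
abstract (generalize (pos_neg P) (pos_neg Q); tauto).
Defined.
Notation "P ⊓ Q" := (Lmeet P Q) (at level 40, left associativity) : L_scope.

(** [!P] *)
Definition Lbang (P : Lprop) : Lprop.
Proof. refine (@mkLprop (pos P) (~ pos P) _); abstract tauto. Defined.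

(** [?P] *)
Definition Lquest (P : Lprop) : Lprop.
Proof. refine (@mkLprop (~ neg P) (neg P) _); abstract tauto. Defined.

Definition affirmative (P : Lprop) : Prop := P ≡ Lbang P.
Definition refutative (P : Lprop) : Prop := P ≡ Lquest P.

Definition disjoint (A : Type) (U V : A -> Prop) : Prop :=
  forall x, ~ (U x /\ V x).

Definition mkLpred (A : Type) (U V : A -> Prop) (D : disjoint U V) : A -> Lprop :=
  fun x => mkLprop (D x).

Definition is_Isubset (A : Type) (R : A -> A -> Prop) (U : A -> Prop) : Prop :=
  Proper (R ==> iff) U.

Record is_Igroup (G : Type) (R : G -> G -> Prop)
    (e : G) (m : G -> G -> G) (i : G -> G) : Prop := {
  Igroup_equiv : Equivalence R;
  Igroup_mul : Proper (R ==> R ==> R) m;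
  Igroup_inv : Proper (R ==> R) i;
  Igroup_unit_l : forall x, R (m e x) x;
  Igroup_unit_r : forall x, R (m x e) x;
  Igroup_inv_l : forall x, R (m (i x) x) e;
  Igroup_inv_r : forall x, R (m x (i x)) e;
  Igroup_assoc : forall x y z, R (m (m x y) z) (m x (m y z)) }.

Record is_Isubgroup (G : Type) (R : G -> G -> Prop)
    (e : G) (m : G -> G -> G) (i : G -> G) (H : G -> Prop) : Prop := {
  Isubgroup_subset : is_Isubset R H;
  Isubgroup_unit : H e;
  Isubgroup_inv : forall x, H x -> H (i x);
  Isubgroup_mul : forall x y, H x -> H y -> H (m x y) }.

Record is_inequality (A : Type) (R N : A -> A -> Prop) : Prop := {
  inequality_irrefl : Irreflexive N;
  inequality_sym : Symmetric N;
  inequality_proper : Proper (R ==> R ==> iff) N }.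

Record is_apartness (A : Type) (R N : A -> A -> Prop) : Prop := {
  apartness_inequality : is_inequality R N;
  apartness_cotrans : forall x y z, N x z -> N x y \/ N y z }.

Record is_tight_apartness (A : Type) (R N : A -> A -> Prop) : Prop := {
  tight_apartness_apartness : is_apartness R N;
  tight_apartness_tight : forall x y, ~ N x y -> R x y }.

Record is_apartness_group (G : Type) (R N : G -> G -> Prop)
    (e : G) (m : G -> G -> G) (i : G -> G) : Prop := {
  apartness_group_group : is_Igroup R e m i;
  apartness_group_tight : is_tight_apartness R N;
  apartness_group_mul : forall x x' y y',
    N (m x y) (m x' y') -> N x x' \/ N y y';
  apartness_group_inv : forall x x', N (i x) (i x') -> N x x' }.

(** Only meaningful when [is_apartness_group R N e m i] holds. *)
Record is_antisubgroup (G : Type) (R N : G -> G -> Prop)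
    (e : G) (m : G -> G -> G) (i : G -> G) (K : G -> Prop) : Prop := {
  antisubgroup_subset : is_Isubset R K;
  antisubgroup_unit : forall x, K x -> N x e;
  antisubgroup_inv : forall x, K (i x) -> K x;
  antisubgroup_mul : forall x y, K (m x y) -> K x \/ K y }.

Record is_Lset (A : Type) (E : A -> A -> Lprop) : Prop := {
  Lset_refl : forall x, ⊢ E x x;
  Lset_sym : forall x y, E x y ⊢ E y x;
  Lset_trans : forall x y z, E x y ⊠ E y z ⊢ E x z }.

Definition Leq_prod (A B : Type) (EA : A -> A -> Lprop) (EB : B -> B -> Lprop) :
    A * B -> A * B -> Lprop :=
  fun p q => (EA (fst p) (fst q) ⊓ EB (snd p) (snd q))%L.

Definition Leq_tensor (A B : Type) (EA : A -> A -> Lprop) (EB : B -> B -> Lprop) :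
    A * B -> A * B -> Lprop :=
  fun p q => (EA (fst p) (fst q) ⊠ EB (snd p) (snd q))%L.

Definition is_Lfunction (A B : Type) (EA : A -> A -> Lprop) (EB : B -> B -> Lprop)
    (f : A -> B) : Prop :=
  forall x1 x2, EA x1 x2 ⊢ EB (f x1) (f x2).

Definition is_Lsubset (A : Type) (E : A -> A -> Lprop) (U : A -> Lprop) : Prop :=
  forall x y, E x y ⊠ U x ⊢ U y.

Record is_Lgroup (G : Type) (E : G -> G -> Lprop)
    (e : G) (m : G -> G -> G) (i : G -> G) : Prop := {
  Lgroup_set : is_Lset E;
  Lgroup_mul : is_Lfunction (Leq_tensor E E) E (uncurry m);
  Lgroup_inv : is_Lfunction E E i;
  Lgroup_unit_l : forall x, ⊢ E (m e x) x;
  Lgroup_unit_r : forall x, ⊢ E (m x e) x;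
  Lgroup_inv_l : forall x, ⊢ E (m (i x) x) e;
  Lgroup_inv_r : forall x, ⊢ E (m x (i x)) e;
  Lgroup_assoc : forall x y z, ⊢ E (m (m x y) z) (m x (m y z)) }.

Definition strong_Lgroup (G : Type) (E : G -> G -> Lprop) (m : G -> G -> G) : Prop :=
  is_Lfunction (Leq_prod E E) E (uncurry m).

Definition affirmative_eq (G : Type) (E : G -> G -> Lprop) : Prop :=
  forall x y, affirmative (E x y).
Definition refutative_eq (G : Type) (E : G -> G -> Lprop) : Prop :=
  forall x y, refutative (E x y).

Record is_Lsubgroup (G : Type) (E : G -> G -> Lprop)
    (e : G) (m : G -> G -> G) (i : G -> G) (H : G -> Lprop) : Prop := {
  Lsubgroup_subset : is_Lsubset E H;
  Lsubgroup_unit : ⊢ H e;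
  Lsubgroup_inv : forall x, H x ⊢ H (i x);
  Lsubgroup_mul : forall x y, H x ⊠ H y ⊢ H (m x y) }.

Definition strong_Lsubgroup (G : Type) (m : G -> G -> G) (H : G -> Lprop) : Prop :=
  forall x y, H x ⊓ H y ⊢ H (m x y).

Definition affirmative_pred (G : Type) (H : G -> Lprop) : Prop :=
  forall x, affirmative (H x).
Definition refutative_pred (G : Type) (H : G -> Lprop) : Prop :=
  forall x, refutative (H x).

Definition eqI (A : Type) (E : A -> A -> Lprop) : A -> A -> Prop :=
  fun x y => pos (E x y).
Definition neqI (A : Type) (E : A -> A -> Lprop) : A -> A -> Prop :=
  fun x y => neg (E x y).

(* Main.v *)
From Stdlib Require Import RelationClasses Morphisms Setoid.
Require Import Defs.

Set Implicit Arguments.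
Unset Strict Implicit.

(** Every clause of the definition of an affine group or subgroup is an entailment
    between pairs, hence splits into a positive and a negative half. The positive
    halves are exactly the intuitionistic axioms. The negative half of an entailment
    out of a tensor gives two implications, one for each premise that is known to
    hold positively; for [(x ≐ y) ⊠ H(x) ⊢ H(y)] these say that [Hbar] respects
    equality and that [H] and [Hbar] are apart, and for [H(x) ⊠ H(y) ⊢ H(xy)] they are
    the two cancellation axioms. An entailment out of a meet has a disjunction as its
    negative half instead, which is the antisubgroup law. These readings are
    [is_Lgroup_iff] and [is_Lsubgroup_iff]; disjointness of [H] and [Hbar], which
    the affine side has built in, follows from [x ∈ H, y ∈ Hbar ⊢ x ≠ y] by
    irreflexivity.

    In the affirmative case all negative halves are contrapositives of positive ones.
    In the refutative strong case two arguments use the group structure.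
    Cotransitivity of [≠] holds because [x = x(y⁻¹y)] and [z = y(y⁻¹z)], so strong
    extensionality of the product separates [x] from [y] or [y⁻¹y] from [y⁻¹z], and
    in the second case the common factor [y⁻¹] cancels ([neqI_cotrans]). And an
    antisubgroup [K] lies apart from its complement because [y ∈ K] splits as
    [x(x⁻¹y)], so [x ∉ K] forces [x⁻¹y ∈ K], whence [x⁻¹y ≠ e] and [y ≠ x]
    ([antisubgroup_apart_complement]). *)

(** * Affine groups in intuitionistic terms *)

(** A valid proposition has an empty refutation, by disjointness of the two parts. *)
Lemma Lvalid_iff (P : Lprop) : ⊢ P <-> pos P.
Proof.
  unfold Lentails; simpl; generalize (pos_neg P); tauto.
Qed.

Lemma Lvalid_eq_iff (A : Type) (E : A -> A -> Lprop) (x y : A) :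
  ⊢ E x y <-> eqI E x y.
Proof.
  apply Lvalid_iff.
Qed.

(** The negative half of transitivity says that [≠] can be transported along an
    equality at either end. *)
Lemma is_Lset_iff (A : Type) (E : A -> A -> Lprop) :
  is_Lset E <-> Equivalence (eqI E) /\ is_inequality (eqI E) (neqI E).
Proof.
  split.
  - intros [Er Es Et].
    assert (eq_sym : Symmetric (eqI E)) by (intros x y; apply (proj1 (Es x y))).
    assert (neq_sym : Symmetric (neqI E)) by (intros x y; apply (proj2 (Es y x))).
    assert (transport : forall x x' y y',
        eqI E x x' -> eqI E y y' -> neqI E x y -> neqI E x' y').
    { intros x x' y y' Hx Hy N.
      apply (proj2 (proj2 (Et x' y' y) (proj1 (proj2 (Et x x' y) N) Hx))).
      now apply eq_sym. }
    split; split; trivial.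
    + intros x. apply (proj1 (Lvalid_eq_iff E x x)), Er.
    + intros x y z Hxy Hyz. apply (proj1 (Et x y z)). now split.
    + intros x N. apply (pos_neg (E x x)). split; trivial.
      apply (proj1 (Lvalid_eq_iff E x x)), Er.
    + intros x x' Hx y y' Hy. split; apply transport; auto.
  - intros [Eq [_ Ns Np]].
    split.
    + intros x. apply Lvalid_eq_iff, (@Equivalence_Reflexive _ _ Eq).
    + intros x y. split; [apply (@Equivalence_Symmetric _ _ Eq) | apply Ns].
    + intros x y z. split.
      * intros [Hxy Hyz]. exact (@Equivalence_Transitive _ _ Eq _ _ _ Hxy Hyz).
      * intros N. split; intros H.
        -- apply (Np _ _ H _ _ (@Equivalence_Reflexive _ _ Eq z)), N.
        -- apply (Np _ _ (@Equivalence_Reflexive _ _ Eq x) _ _ H), N.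
Qed.

(** Multiplication on the tensor product is only required to reflect [≠] in one
    argument while the other stays fixed up to equality; since [≠] respects equality,
    the varying representatives can be replaced by one fixed element. *)
Lemma is_Lgroup_iff (G : Type) (e : G) (m : G -> G -> G) (i : G -> G)
    (E : G -> G -> Lprop) :
  is_Lgroup E e m i <->
  (is_Igroup (eqI E) e m i /\ is_inequality (eqI E) (neqI E) /\
   (forall x y y', neqI E (m x y) (m x y') -> neqI E y y') /\
   (forall x x' y, neqI E (m x y) (m x' y) -> neqI E x x') /\
   (forall x x', neqI E (i x) (i x') -> neqI E x x')).
Proof.
  split.
  - intros [ES Em Ei Ul Ur Il Ir As].
    destruct (proj1 (is_Lset_iff E) ES) as [Eq Ineq].
    split; [split | split; [exact Ineq | split; [| split]]]; try exact Eq;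
      try (intros; apply -> Lvalid_eq_iff; auto; fail).
    + intros x x' Hx y y' Hy. apply (proj1 (Em (x, y) (x', y'))). now split.
    + intros x x'. apply (proj1 (Ei x x')).
    + intros x y y' N. apply (proj1 (proj2 (Em (x, y) (x, y')) N)).
      apply (@Equivalence_Reflexive _ _ Eq).
    + intros x x' y N. apply (proj2 (proj2 (Em (x, y) (x', y)) N)).
      apply (@Equivalence_Reflexive _ _ Eq).
    + intros x x'. apply (proj2 (Ei x x')).
  - intros [[Eq Pm Pi Ul Ur Il Ir As] [Ineq [Nl [Nr Ni]]]].
    pose proof (inequality_proper Ineq) as Np.
    split; try (intros; apply <- Lvalid_eq_iff; auto; fail).
    + apply is_Lset_iff. now split.
    + intros [x y] [x' y']. split.
      * intros [Hx Hy]. exact (Pm _ _ Hx _ _ Hy).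
      * intros N; change (neqI E (m x y) (m x' y')) in N.
        split; simpl; intros H.
        -- apply (Nl x'). refine (proj1 (Np _ _ _ _ _ _) N).
           ++ apply Pm; [exact H | reflexivity].
           ++ reflexivity.
        -- apply (Nr _ _ y'). refine (proj1 (Np _ _ _ _ _ _) N).
           ++ apply Pm; [reflexivity | exact H].
           ++ reflexivity.
    + intros x x'. split; [apply Pi | apply Ni].
Qed.

Lemma affirmative_iff (P : Lprop) : affirmative P <-> (neg P <-> ~ pos P).
Proof.
  unfold affirmative, Lequiv, Lentails; simpl; generalize (pos_neg P); tauto.
Qed.

Lemma refutative_iff (P : Lprop) : refutative P <-> (pos P <-> ~ neg P).
Proof.
  unfold refutative, Lequiv, Lentails; simpl; generalize (pos_neg P); tauto.
Qed.

(** Denial of equality is an inequality, and each [≠]-reflecting law is the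
    contrapositive of a congruence law. *)
Lemma Igroup_denial_Lgroup (G : Type) (e : G) (m : G -> G -> G) (i : G -> G)
    (E : G -> G -> Lprop) :
  is_Igroup (eqI E) e m i -> (forall x y, neqI E x y <-> ~ eqI E x y) ->
  is_Lgroup E e m i.
Proof.
  intros IG NE. pose proof IG as [Eq Pm Pi _ _ _ _ _].
  apply is_Lgroup_iff.
  split; [exact IG | split; [split | repeat split]].
  - intros x N. apply NE in N. apply N. reflexivity.
  - intros x y N. apply NE. apply NE in N. intros H. apply N. now symmetry.
  - intros x x' Hx y y' Hy. rewrite !NE, Hx, Hy. reflexivity.
  - intros x y y' N. apply NE. apply NE in N. intros H. apply N. now rewrite H.
  - intros x x' y N. apply NE. apply NE in N. intros H. apply N. now rewrite H.
  - intros x x' N. apply NE. apply NE in N. intros H. apply N. now rewrite H.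
Qed.

(** * Affine subgroups in intuitionistic terms *)

Lemma apart_disjoint (G : Type) (E : G -> G -> Lprop) (H Hbar : G -> Prop) :
  Irreflexive (neqI E) -> (forall x y, H x /\ Hbar y -> neqI E x y) ->
  disjoint H Hbar.
Proof.
  intros Irr Ap x Hx. exact (Irr x (Ap x x Hx)).
Qed.

(** Negating [(x ≐ y) ⊠ H(x) ⊢ H(y)] at [y ∈ Hbar] yields one implication from
    [x = y], namely that [Hbar] is an intuitionistic subset, and one from [x ∈ H], which
    is apartness from [H]; closure under products splits in the same way into left
    and right cancellation. *)
Lemma is_Lsubgroup_iff (G : Type) (e : G) (m : G -> G -> G) (i : G -> G)
    (E : G -> G -> Lprop) (H Hbar : G -> Prop) (D : disjoint H Hbar) :
  Symmetric (eqI E) ->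
  is_Lsubgroup E e m i (mkLpred D) <->
  (is_Isubgroup (eqI E) e m i H /\
   is_Isubset (eqI E) Hbar /\
   (forall x y, H x /\ Hbar y -> neqI E x y) /\
   (forall x, Hbar (i x) -> Hbar x) /\
   (forall x y, Hbar (m x y) /\ H x -> Hbar y) /\
   (forall x y, Hbar (m x y) /\ H y -> Hbar x)).
Proof.
  intros Sy. split.
  - intros [Su Un Iv Mu].
    assert (P : forall x y, eqI E x y -> H x -> H y)
      by (intros x y Hxy Hx; apply (proj1 (Su x y)); now split).
    assert (Pbar : forall x y, eqI E x y -> Hbar y -> Hbar x)
      by (intros x y Hxy Hy; exact (proj1 (proj2 (Su x y) Hy) Hxy)).
    split; [split | split; [| split; [| split; [| split]]]].
    + intros x y Hxy. split; apply P; auto.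
    + apply (proj1 Un I).
    + intros x. apply (proj1 (Iv x)).
    + intros x y Hx Hy. apply (proj1 (Mu x y)). now split.
    + intros x y Hxy. split; apply Pbar; auto.
    + intros x y [Hx Hy]. exact (proj2 (proj2 (Su x y) Hy) Hx).
    + intros x. apply (proj2 (Iv x)).
    + intros x y [Hxy Hx]. exact (proj1 (proj2 (Mu x y) Hxy) Hx).
    + intros x y [Hxy Hy]. exact (proj2 (proj2 (Mu x y) Hxy) Hy).
  - intros [[P Un Iv Mu] [Pbar [Ap [Ivbar [Ml Mr]]]]]. split.
    + intros x y. split.
      * intros [Hxy Hx]. exact (proj1 (P _ _ Hxy) Hx).
      * intros Hy. split; intros Hx.
        -- exact (proj2 (Pbar _ _ Hx) Hy).
        -- apply Ap. now split.
    + now apply Lvalid_iff.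
    + intros x. split; [apply Iv | apply Ivbar].
    + intros x y. split.
      * intros [Hx Hy]. now apply Mu.
      * intros Hxy. split; intros K; [apply (Ml x) | apply (Mr x y)]; now split.
Qed.

(** The negative half of strength is the disjunctive axiom, and disjointness of [H]
    and [Hbar] makes it imply both cancellation axioms. *)
Lemma strong_Lsubgroup_iff (G : Type) (e : G) (m : G -> G -> G) (i : G -> G)
    (E : G -> G -> Lprop) (H Hbar : G -> Prop) (D : disjoint H Hbar) :
  Symmetric (eqI E) ->
  is_Lsubgroup E e m i (mkLpred D) /\ strong_Lsubgroup m (mkLpred D) <->
  (is_Isubgroup (eqI E) e m i H /\
   is_Isubset (eqI E) Hbar /\
   (forall x y, H x /\ Hbar y -> neqI E x y) /\
   (forall x, Hbar (i x) -> Hbar x) /\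
   (forall x y, Hbar (m x y) -> Hbar x \/ Hbar y)).
Proof.
  intros Sy. rewrite (is_Lsubgroup_iff e m i D Sy). split.
  - intros [[S [Pbar [Ap [Iv _]]]] Str]. do 4 (split; [assumption |]).
    intros x y. exact (proj2 (Str x y)).
  - intros [S [Pbar [Ap [Iv Mu]]]]. split; [do 4 (split; [assumption |]); split |].
    + intros x y [Hxy Hx]. destruct (Mu _ _ Hxy); [destruct (D x); now split | trivial].
    + intros x y [Hxy Hy]. destruct (Mu _ _ Hxy); [trivial | destruct (D y); now split].
    + intros x y. split; [intros [Hx Hy]; now apply S | apply Mu].
Qed.

(** * Refutative strong groups and antisubgroups *)

(** The two factorizations [x = x(y⁻¹y)] and [z = y(y⁻¹z)] are chosen so that their
    left factors compare [x] with [y], and their right factors compare [y] with [z] after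
    the same left translation. *)
Lemma neqI_cotrans (G : Type) (e : G) (m : G -> G -> G) (i : G -> G)
    (E : G -> G -> Lprop) :
  is_Lgroup E e m i -> strong_Lgroup E m ->
  forall x y z, neqI E x z -> neqI E x y \/ neqI E y z.
Proof.
  intros LG Str x y z N.
  destruct (proj1 (is_Lgroup_iff _ _ _ _) LG)
    as [[Eq Pm _ Ul Ur Il Ir As] [Ineq [Nl _]]].
  assert (N' : neqI E (m x (m (i y) y)) (m y (m (i y) z))).
  { refine (proj2 (inequality_proper Ineq _ _) N).
    - now rewrite Il, Ur.
    - now rewrite <- As, Ir, Ul. }
  destruct (proj2 (Str (x, m (i y) y) (y, m (i y) z)) N') as [K | K]; simpl in K.
  - now left.
  - right. exact (Nl _ _ _ K).
Qed.

Lemma refutative_strong_apartness_group (G : Type) (e : G) (m : G -> G -> G)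
    (i : G -> G) (E : G -> G -> Lprop) :
  is_Lgroup E e m i -> refutative_eq E -> strong_Lgroup E m ->
  is_apartness_group (eqI E) (neqI E) e m i.
Proof.
  intros LG Ref Str.
  destruct (proj1 (is_Lgroup_iff _ _ _ _) LG) as [IG [Ineq [_ [_ Ni]]]].
  split; [assumption | split; [split |] | | assumption].
  - assumption.
  - exact (neqI_cotrans LG Str).
  - intros x y. apply (proj1 (refutative_iff _) (Ref x y)).
  - intros x x' y y'. exact (proj2 (Str (x, y) (x', y'))).
Qed.

(** Writing [y = x(x⁻¹y)] turns membership of [y] into [x⁻¹y ≠ e = x⁻¹x], from which
    [x⁻¹] cancels. *)
Lemma antisubgroup_apart_complement (G : Type) (e : G) (m : G -> G -> G)
    (i : G -> G) (E : G -> G -> Lprop) (K : G -> Prop) :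
  is_Lgroup E e m i -> is_antisubgroup (eqI E) (neqI E) e m i K ->
  forall x y, ~ K x -> K y -> neqI E x y.
Proof.
  intros LG [PK UK _ MK] x y Hx Hy.
  destruct (proj1 (is_Lgroup_iff _ _ _ _) LG)
    as [[Eq Pm _ Ul _ Il Ir As] [Ineq [Nl _]]].
  assert (Hy' : K (m x (m (i x) y))).
  { refine (proj2 (PK _ _ _) Hy). now rewrite <- As, Ir, Ul. }
  destruct (MK _ _ Hy') as [Kx | Kxy]; [contradiction |].
  apply (inequality_sym Ineq), (Nl (i x)).
  refine (proj2 (inequality_proper Ineq _ _) (UK _ Kxy)).
  - reflexivity.
  - apply Il.
Qed.

Lemma antisubgroup_complement_subgroup (G : Type) (R N : G -> G -> Prop) (e : G)
    (m : G -> G -> G) (i : G -> G) (K H : G -> Prop) :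
  Irreflexive N -> is_antisubgroup R N e m i K -> (forall x, H x <-> ~ K x) ->
  is_Isubgroup R e m i H.
Proof.
  intros Irr [PK UK IK MK] HK. split.
  - intros x y Hxy. now rewrite !HK, (PK _ _ Hxy).
  - apply HK. intros Ke. exact (Irr e (UK _ Ke)).
  - intros x Hx. apply HK. apply HK in Hx. intros Kx. now apply Hx, IK.
  - intros x y Hx Hy. apply HK. apply HK in Hx, Hy. intros Kxy.
    destruct (MK _ _ Kxy); contradiction.
Qed.

Theorem theorem7p5 (G : Type) (e : G) (m : G -> G -> G) (i : G -> G)
    (E : G -> G -> Lprop) :
  (* the L-subgroups of an L-group, as pairs of intuitionistic predicates *)
  (is_Lgroup E e m i ->
     is_Igroup (eqI E) e m i /\
     forall H Hbar : G -> Prop,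
       (exists D : disjoint H Hbar, is_Lsubgroup E e m i (mkLpred D)) <->
       (is_Isubgroup (eqI E) e m i H /\
        is_Isubset (eqI E) Hbar /\
        (forall x y, H x /\ Hbar y -> neqI E x y) /\
        (forall x, Hbar (i x) -> Hbar x) /\
        (forall x y, Hbar (m x y) /\ H x -> Hbar y) /\
        (forall x y, Hbar (m x y) /\ H y -> Hbar x)))
  /\
  (* strong L-subgroups *)
  (is_Lgroup E e m i ->
     forall H Hbar : G -> Prop,
       (exists D : disjoint H Hbar,
          is_Lsubgroup E e m i (mkLpred D) /\ strong_Lsubgroup m (mkLpred D)) <->
       (is_Isubgroup (eqI E) e m i H /\
        is_Isubset (eqI E) Hbar /\
        (forall x y, H x /\ Hbar y -> neqI E x y) /\
        (forall x, Hbar (i x) -> Hbar x) /\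
        (forall x y, Hbar (m x y) -> Hbar x \/ Hbar y)))
  /\
  (* affirmative L-subgroups of affirmative L-groups *)
  (forall H Hbar : G -> Prop,
     (is_Lgroup E e m i /\ affirmative_eq E /\
      exists D : disjoint H Hbar,
        is_Lsubgroup E e m i (mkLpred D) /\ affirmative_pred (mkLpred D)) <->
     (is_Igroup (eqI E) e m i /\ (forall x y, neqI E x y <-> ~ eqI E x y) /\
      is_Isubgroup (eqI E) e m i H /\ (forall x, Hbar x <-> ~ H x)))
  /\
  (* refutative strong L-subgroups of refutative strong L-groups *)
  (is_Lgroup E e m i -> refutative_eq E -> strong_Lgroup E m ->
     is_apartness_group (eqI E) (neqI E) e m i /\
     forall H Hbar : G -> Prop,
       (exists D : disjoint H Hbar,
          is_Lsubgroup E e m i (mkLpred D) /\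
          refutative_pred (mkLpred D) /\ strong_Lsubgroup m (mkLpred D)) <->
       (is_antisubgroup (eqI E) (neqI E) e m i Hbar /\
        (forall x, H x <-> ~ Hbar x))).
Proof.
  assert (Sy : is_Lgroup E e m i -> Symmetric (eqI E)).
  { intros LG. apply is_Lgroup_iff in LG.
    apply (@Equivalence_Symmetric _ _ (Igroup_equiv (proj1 LG))). }
  assert (Irr : is_Lgroup E e m i -> Irreflexive (neqI E)).
  { intros LG. apply is_Lgroup_iff in LG. apply LG. }
  split; [| split; [| split]].
  - intros LG. split; [now apply (is_Lgroup_iff e m i E) |].
    intros H Hbar. split.
    + intros [D S]. now apply (is_Lsubgroup_iff e m i D (Sy LG)).
    + intros S. exists (apart_disjoint (Irr LG) (proj1 (proj2 (proj2 S)))).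
      now apply (is_Lsubgroup_iff e m i _ (Sy LG)).
  - intros LG H Hbar. split.
    + intros [D S]. now apply (strong_Lsubgroup_iff e m i D (Sy LG)).
    + intros S. exists (apart_disjoint (Irr LG) (proj1 (proj2 (proj2 S)))).
      now apply (strong_Lsubgroup_iff e m i _ (Sy LG)).
  - intros H Hbar. split.
    + intros [LG [AE [D [S AH]]]].
      apply (is_Lsubgroup_iff e m i D (Sy LG)) in S.
      split; [| split; [| split]].
      * apply (is_Lgroup_iff e m i E), LG.
      * intros x y. apply (proj1 (affirmative_iff _) (AE x y)).
      * apply S.
      * intros x. apply (proj1 (affirmative_iff _) (AH x)).
    + intros [IG [NE [S HE]]].
      pose proof (Igroup_denial_Lgroup IG NE) as LG.
      pose proof S as [P _ Iv Mu].
      assert (D : disjoint H Hbar)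
        by (intros x [Hx Hx']; now apply HE in Hx').
      split; [exact LG | split; [| exists D; split]].
      * intros x y. apply affirmative_iff, NE.
      * apply (is_Lsubgroup_iff e m i D (Sy LG)).
        destruct IG as [Eq Pm Pi Ul Ur Il Ir As].
        split; [exact S | split; [| split; [| split; [| split]]]].
        -- intros x y Hxy. now rewrite !HE, (P _ _ Hxy).
        -- intros x y [Hx Hy]. apply NE. apply HE in Hy. intros Hxy.
           now apply Hy, (P _ _ Hxy).
        -- intros x. rewrite !HE. auto.
        -- intros x y. rewrite !HE. intros [Hxy Hx] Hy. auto.
        -- intros x y. rewrite !HE. intros [Hxy Hy] Hx. auto.
      * intros x. apply affirmative_iff, HE.
  - intros LG Ref Str.
    split; [now apply refutative_strong_apartness_group |].
    intros H Hbar. split.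
    + intros [D [S [RH StrH]]].
      destruct (proj1 (strong_Lsubgroup_iff e m i D (Sy LG)) (conj S StrH))
        as [IS [Pbar [Ap [Iv Mu]]]].
      split; [split; try assumption |].
      * intros x Hx. apply (proj2 (Lset_sym (Lgroup_set LG) x e)), Ap.
        split; [apply IS | exact Hx].
      * intros x. apply (proj1 (refutative_iff _) (RH x)).
    + intros [AS HK].
      assert (D : disjoint H Hbar)
        by (intros x [Hx Hx']; now apply HK in Hx).
      exists D.
      enough (is_Lsubgroup E e m i (mkLpred D) /\ strong_Lsubgroup m (mkLpred D))
        as [S StrH]
        by (split; [exact S | split; [| exact StrH]];
            intros x; apply refutative_iff, HK).
      apply (strong_Lsubgroup_iff e m i D (Sy LG)).
      split; [exact (antisubgroup_complement_subgroup (Irr LG) AS HK) |].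
      split; [apply AS | split; [| split; apply AS]].
      intros x y [Hx Hy].
      apply (antisubgroup_apart_complement LG AS); [now apply HK | exact Hy].
Qed.
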